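(* Let $K/\mathbb{Q}$ be a Galois extension of degree $6$. Then there is an algebraic unit in $K$ which is wandering under iteration of the Mahler measure $M$ if and only if $K$ is totally real.
   Context: Fix an algebraic closure $\overline{\mathbb{Q}}\subseteq\mathbb{C}$ of $\mathbb{Q}$; number fields are subfields of $\overline{\mathbb{Q}}$. For $\alpha\in\overline{\mathbb{Q}}$ with (primitive) minimal polynomial $f(x)=a_nx^n+\cdots+a_0=a_n(x-\alpha_1)\cdots(x-\alpha_n)\in\mathbb{Z}[x]$ (so $f$ is irreducible in $\mathbb{Z}[x]$), the Mahler measure of $\alpha$ is $M(\alpha)=|a_n|\prod_{i=1}^n\max\{1,|\alpha_i|\}$. This is again an algebraic number, so $M$ is a map $\overline{\mathbb{Q}}\to\overline{\mathbb{Q}}$. Put $M^0(\alpha)=\alpha$ and $M^n(\alpha)=M(M^{n-1}(\alpha))$ for $n\ge1$. The point $\alpha$ is wandering (under iteration of $M$) if its forward orbit $\{M^n(\alpha):n\ge0\}$ is infinite. An algebraic unit in $K$ is a unit of the ring of integers of $K$. *)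

(* Defs.v *)
From HB Require Import structures.
From mathcomp Require Import all_boot all_order all_algebra all_fingroup.
From mathcomp Require Import all_solvable all_field.
From mathcomp Require Import boolp classical_sets functions cardinality.

Set Implicit Arguments.
Unset Strict Implicit.
Unset Printing Implicit Defensive.

Import Order.TTheory GRing.Theory Num.Theory.
Local Open Scope ring_scope.

(* The field algC of algebraic complex numbers plays the role of the algebraic
   closure of Q in C. *)

(* The primitive minimal polynomial in Z[x]: clear the denominators of the monic
   minimal polynomial over Q, then divide by the content. The content has the
   sign of the leading coefficient, so the result has lead_coef > 0. *)
Definition minZpoly (a : algC) : {poly int} :=
  zprimitive (projT1 (rat_poly_scale (s2val (minCpolyP a)))).

Lemma minZpoly_neq0 a : minZpoly a != 0.
Proof.
rewrite /minZpoly zprimitive_eq0; case: (minCpolyP a) => p [Dp mon_p] min_p.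
rewrite [s2val _]/=; case: rat_poly_scale => q [b nz_b Dq]; rewrite [projT1 _]/=.
apply: contraTneq mon_p => q0.
by rewrite Dq q0 map_poly0 scaler0 monicE lead_coef0 eq_sym oner_eq0.
Qed.

Lemma minZpoly_primitive a : zcontents (minZpoly a) = 1.
Proof.
have := minZpoly_neq0 a; rewrite /minZpoly zprimitive_eq0 => nz.
by rewrite zcontents_primitive nz.
Qed.

Lemma minZpolyE a :
  map_poly intr (minZpoly a) = (lead_coef (minZpoly a))%:~R *: minCpoly a.
Proof.
suffices [c Dc]: exists c, map_poly intr (minZpoly a) = c *: minCpoly a.
  have Dl := congr1 lead_coef Dc.
  rewrite lead_coefZ (monicP (minCpoly_monic a)) mulr1 in Dl.
  by rewrite Dc -Dl lead_coef_map_inj //; apply: intr_inj.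
have := minZpoly_neq0 a; rewrite /minZpoly.
case: (minCpolyP a) => p [Dp mon_p] min_p; rewrite [s2val _]/=.
case: rat_poly_scale => q [b nz_b Dq]; rewrite [projT1 _]/= => nz_q.
rewrite zprimitive_eq0 in nz_q.
exists ((zcontents q)%:~R^-1 * b%:~R).
have ratr_intr: map_poly ratr (map_poly intr q) = map_poly intr q :> {poly algC}.
  by rewrite -[LHS]map_poly_comp; apply: eq_map_poly => z; rewrite [LHS]rmorph_int.
rewrite Dp Dq map_polyZ /= fmorphV rmorph_int ratr_intr.
rewrite scalerA mulfK ?intr_eq0 // {3}[q]zpolyEprim map_polyZ /=.
by rewrite scalerA mulVf ?scale1r // intr_eq0 zcontents_eq0.
Qed.

(* All complex roots, listed with multiplicity. *)
Definition complex_roots (f : {poly int}) : seq algC :=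
  sval (closed_field_poly_normal (map_poly intr f)).

Definition mahler (a : algC) : algC :=
  `|lead_coef (minZpoly a)|%:~R *
    \prod_(z <- complex_roots (minZpoly a)) Num.max 1 `|z|.

Definition wandering (a : algC) : Prop :=
  infinite_set (range (fun n : nat => iter n mahler a)).

Definition in_ring_of_integers (K : fieldExtType rat) (x : K) : Prop :=
  integralOver (intr : int -> K) x.

Definition algebraic_unit (K : fieldExtType rat) (u : K) : Prop :=
  in_ring_of_integers u /\
  exists2 v : K, in_ring_of_integers v & u * v = 1.

(* Every field embedding of K into C has its image in algC. *)
Definition totally_real (K : fieldExtType rat) : Prop :=
  forall (s : {rmorphism K -> algC}) (x : K), s x \is Num.real.

(* Main.v *)
Require Import Defs.
From mathcomp Require Import boolp classical_sets cardinality.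
From mathcomp Require Import all_boot all_order all_algebra all_field.
From mathcomp Require Import all_fingroup all_solvable.

(** Up to sign, the Mahler measure of a unit u of K is the product of those
    conjugates of u that lie outside the unit circle, and all conjugates stay
    in K because K is Galois.

    Suppose first that K is not totally real.  The set of conjugates of u
    outside the unit circle is stable under complex conjugation, so their
    product is real, and M(u) is a real unit w of K ([mahler_real_unit]).
    A real element cannot generate a field with non-real elements, so the
    degree of w is a proper divisor of 6, hence at most 3
    ([size_conjugates_real]).  The absolute values of the conjugates of w have
    product 1, so at most one of these is outside the unit circle or at most
    one is inside; since M(w) = M(1/w), the first case may be assumed.  Then
    either M(w) = 1 or the only outer conjugate z of w is real with
    M(w) = |z|, and M(M(w)) = M(z) = M(w) ([mahler_cubic]).  So every orbit of
    a unit of K is finite.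

    Now let K be totally real, and let r and t be elements of orders 3 and 2
    of its Galois group, which they generate.  Call w hexagonal if t w = 1/w,
    w * r w * r^2 w = 1 and |w| <> 1.  The six conjugates of a hexagonal unit
    are then distinct and of the form a, b, c, 1/a, 1/b, 1/c with abc = 1:
    their logarithms are arranged like the roots of a root system of type A2.
    Of three real numbers with sum 0, the sum of the absolute values is twice
    the largest absolute value; hence M(w) = |z|^2 for a conjugate z of w
    ([hexagon_max], [mahler_hexagonal_sqr]).  Powers of hexagonal units are
    hexagonal and M(w^k) = M(w)^k, so the (n+1)-st iterate of M at w is
    M(w)^(2^n), where M(w) > 1 ([hexagonal_wandering]).

    A hexagonal unit is e * t(r e) / (r e * t e), where e is a unit all of
    whose conjugates other than e itself have absolute value < 1
    ([hexagonal_unit_exists]): the two algebraic conditions hold formally, and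
    the bounds on the conjugates of e exclude |w| = 1.  The unit e comes from
    the classical argument of Dirichlet.  In a lattice of algebraic integers of
    K, the box principle provides elements of bounded norm that are as small as
    desired at all conjugates but one ([small_combination],
    [small_lattice_element]).  Two terms of a sequence of such elements,
    shrinking at each of these conjugates, are congruent modulo a common
    multiple of their norms, and their quotient is the unit e
    ([lattice_dirichlet_unit]). *)

Set Implicit Arguments.
Unset Strict Implicit.
Unset Printing Implicit Defensive.

Import Order.TTheory GRing.Theory Num.Theory.
Local Open Scope ring_scope.

(** * Products, iterates and the hexagon inequality *)

Lemma prod_le1 (R : numDomainType) (I : Type) (s : seq I) (P : pred I)
    (F : I -> R) :
  (forall i, P i -> 0 <= F i <= 1) -> \prod_(i <- s | P i) F i <= 1.
Proof.
move=> F01; apply: le_trans (_ : _ <= \prod_(i <- s | P i) 1) _.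
  exact: ler_prod.
by rewrite big1.
Qed.

Lemma prod_ge1 (R : numDomainType) (I : Type) (s : seq I) (P : pred I)
    (F : I -> R) :
  (forall i, P i -> 1 <= F i) -> 1 <= \prod_(i <- s | P i) F i.
Proof.
move=> F1; apply: le_trans (_ : \prod_(i <- s | P i) 1 <= _).
  by rewrite big1.
by apply: ler_prod => i /F1 ->; rewrite ler01.
Qed.

Lemma big_cycle3 (gT : finGroupType) (r : gT) (R : comPzSemiRingType)
    (F : gT -> R) :
  #[r]%g = 3%N ->
  \prod_(h in <[r]>%g) F h = F 1%g * (F r * F (r * r)%g).
Proof.
move=> or3; pose s := traject (mulg r) 1%g 3.
have mem_s : <[r]>%g =i s by rewrite /s -or3; apply: cycle_traject.
have uniq_s : uniq s.
  by apply/card_uniqP; rewrite size_traject -(eq_card mem_s) -or3.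
rewrite (eq_bigl _ _ mem_s) -big_uniq //=.
by rewrite !big_cons big_nil !mulg1 mulr1.
Qed.

Lemma infinite_range (T : Type) (f : nat -> T) :
  injective f -> infinite_set (range f).
Proof.
move=> f_inj fin; apply: infinite_nat.
have := @finite_preimage _ _ (range f) f (in2W f_inj) fin.
by apply: sub_finite_set => k _; exists k.
Qed.

Lemma iter_idem_finite (T : Type) (f : T -> T) (x : T) k :
  f (iter k f x) = iter k f x ->
  finite_set (range (fun n => iter n f x)).
Proof.
move=> fk; pose orbit := ((fun n => iter n f x) @` `I_k.+1)%classic.
apply: (@sub_finite_set _ _ orbit); last first.
  exact/finite_image/finite_II.
move=> _ [n _ <-]; exists (minn n k); rewrite /= ?ltnS ?geq_minr //.
have [//|/ltnW le_kn] := leqP n k; rewrite -(subnK le_kn) iterD.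
by elim: (n - k)%N => //= m <-.
Qed.

Lemma max1_if (a : algC) : Num.max 1 a = if 1 < a then a else 1.
Proof. by []. Qed.

Lemma max1_ge1 (a : algC) : 1 <= Num.max 1 a.
Proof. by rewrite max1_if; case: ifP => // /ltW. Qed.

Lemma max1_mul_max1V (x : algC) : 0 < x ->
  Num.max 1 x * Num.max 1 x^-1 = if 1 < x then x else x^-1.
Proof.
move=> x_gt0; rewrite !max1_if invf_gt1 //.
have [lt1|lt1|<-] := real_ltgtP (rpred1 _) (gtr0_real x_gt0).
- by rewrite mulr1.
- by rewrite mul1r.
by rewrite invr1 mulr1.
Qed.

(** If x, y, z are not all on the same side of 1, one of them, say x, is alone
    on its side; the factors of the other two then multiply to (y * z)^-1 or y
    * z, which equals the factor of x because x * y * z = 1. The strict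
    inequality excludes the degenerate case x = y = z = 1. *)
Lemma hexagon_max (x y z : algC) (m := fun x => Num.max 1 x * Num.max 1 x^-1) :
    0 < x -> 0 < y -> 0 < z -> x * (y * z) = 1 -> 1 < m x * (m y * m z) ->
  exists2 v, v \in [:: x; y; z; x^-1; y^-1; z^-1]
    & m x * (m y * m z) = v ^+ 2.
Proof.
move=> x0 y0 z0 xyz; rewrite /m !max1_mul_max1V //.
have Dx : x^-1 = y * z by rewrite -[x^-1]mulr1 -xyz mulKf // gt_eqF.
have Dy : y^-1 = x * z by rewrite -[y^-1]mulr1 -xyz mulrCA mulKf // gt_eqF.
have Dz : z^-1 = x * y by rewrite -[z^-1]mulr1 -xyz mulrA mulrC mulfK // gt_eqF.
case: (1 < x); case: (1 < y); case: (1 < z).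
- by rewrite xyz ltxx.
- by move=> _; exists z^-1; rewrite ?inE ?eqxx ?orbT // expr2 {2}Dz mulrA.
- by move=> _; exists y^-1; rewrite ?inE ?eqxx ?orbT // expr2 {2}Dy mulrCA mulrC.
- by move=> _; exists x; rewrite ?inE ?eqxx ?orbT // expr2 -invfM -Dx invrK.
- by move=> _; exists x^-1; rewrite ?inE ?eqxx ?orbT // expr2 -Dx.
- by move=> _; exists y; rewrite ?inE ?eqxx ?orbT // expr2 mulrCA -invfM -Dy invrK.
- by move=> _; exists z; rewrite ?inE ?eqxx ?orbT // expr2 mulrA -invfM -Dz invrK.
by rewrite -!invfM xyz invr1 ltxx.
Qed.

(** * The box principle *)

Lemma truncn_close (R : archiNumDomainType) (x y : R) :
  0 <= x -> 0 <= y -> Num.truncn x = Num.truncn y -> `|x - y| <= 1.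
Proof.
move=> x_ge0 y_ge0 e.
have Rx : x - y \is Num.real by rewrite rpredB ?ger0_real.
have /andP[lx ux] := truncn_itv x_ge0; have /andP[ly uy] := truncn_itv y_ge0.
rewrite real_ler_norml //; rewrite e in lx ux; apply/andP; split.
  by rewrite lerBrDr addrC lerBlDr (le_trans (ltW uy)) // -natr1 lerD2r.
by rewrite lerBlDr (le_trans (ltW ux)) // -natr1 addrC lerD2l.
Qed.

(** Dirichlet's box principle for one form fewer than there are variables: the
    exponents are balanced so that the product of the bound on the coefficients
    and of the #|J| bounds on the forms does not depend on q. *)
Lemma small_combination (R : archiNumFieldType) (I J : finType)
    (L : J -> I -> R) (B q : nat) :
    (forall j i, L j i \is Num.real) -> (forall j, \sum_i `|L j i| <= B%:R) ->
    #|I| = #|J|.+1 -> (0 < q)%N ->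
  exists c : {ffun I -> int}, [/\ exists i, c i != 0,
    forall i, (`|c i| <= q ^ #|J|)%N &
    forall j, `|\sum_i (c i)%:~R * L j i| <= (2 * B).+1%:R / q%:R].
Proof.
(* The forms take values in intervals of length 2 B Q on the vectors with
   entries in 0..Q.  Intervals of width W cut these into fewer than q ^ #|I|
   pieces each, so there are at most (q ^ #|I|) ^ #|J| = Q ^ #|I| boxes for
   the (Q + 1) ^ #|I| vectors. *)
move=> RL leB cardI q_gt0; set Q := (q ^ #|J|)%N; set W := _ / _.
have W_gt0 : 0 < W by rewrite divr_gt0 ?ltr0n.
pose lin (a : {ffun I -> 'I_Q.+1}) j := \sum_i (a i)%:R * L j i.
have Rlin a j : lin a j \is Num.real.
  by apply: rpred_sum => i _; rewrite rpredM ?realn.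
have lin_le a j : `|lin a j| <= (Q * B)%:R.
  rewrite natrM (le_trans (ler_norm_sum _ _ _)) //.
  rewrite (le_trans (y := \sum_i Q%:R * `|L j i|)) //; last first.
    by rewrite -mulr_sumr ler_wpM2l ?ler0n.
  apply: ler_sum => i _; rewrite normrM normr_nat ler_wpM2r //.
  by rewrite ler_nat -ltnS.
have lin_itv a j : 0 <= lin a j + (Q * B)%:R <= (2 * (Q * B))%:R.
  have := lin_le a j; rewrite real_ler_norml // => /andP[lb ub].
  by rewrite -lerBlDr sub0r lb mul2n -addnn natrD lerD2r.
pose box a j := Num.truncn ((lin a j + (Q * B)%:R) / W).
have y_ge0 a j : 0 <= (lin a j + (Q * B)%:R) / W.
  by rewrite divr_ge0 ?(ltW W_gt0) //; case/andP: (lin_itv a j).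
have box_lt a j : (box a j < q ^ #|I|)%N.
  rewrite truncn_lt_nat // ltr_pdivrMr // /W mulrA ltr_pdivlMr ?ltr0n //.
  have /andP[_ ub] := lin_itv a j.
  rewrite (le_lt_trans (ler_wpM2r (ler0n _ _) ub)) // -!natrM ltr_nat.
  rewrite cardI expnS -/Q [(2 * _)%N]mulnCA [(_ * q)%N]mulnC mulnA.
  by rewrite ltn_pmul2l ?ltnSn // muln_gt0 q_gt0 expn_gt0 q_gt0.
pose boxes a := [ffun j => Ordinal (box_lt a j)].
have : ~~ injectiveb boxes.
  apply/injectiveP => /leq_card; rewrite !card_ffun !card_ord leqNgt.
  by rewrite -expnM mulnC expnM ltn_exp2r ?ltnSn // cardI.
case/injectivePn => a [a' neq_a /ffunP eq_box].
exists [ffun i => (a i)%:Z - (a' i)%:Z]; split.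
- have [i ne_i] : exists i, a i != a' i.
    apply/existsP; rewrite -negb_forall; apply: contra neq_a => /forallP eq_a.
    by apply/eqP/ffunP => i; apply/eqP.
  by exists i; rewrite ffunE subr_eq0 eqz_nat.
- move=> i; rewrite ffunE -lez_nat abszE ler_norml lerBrDr lerBlDr.
  have h (b : {ffun I -> 'I_Q.+1}) : (b i <= Q)%N by rewrite -ltnS.
  rewrite addrC lerBlDr -!PoszD !lez_nat.
  by rewrite (leq_trans (h a')) ?leq_addl // (leq_trans (h a)) ?leq_addr.
move=> j; have := congr1 val (eq_box j); rewrite !ffunE /= => /truncn_close.
move=> /(_ (y_ge0 _ _) (y_ge0 _ _)).
rewrite -mulrBl normrM normfV (gtr0_norm W_gt0) ler_pdivrMr // mul1r.
rewrite opprD addrACA subrr addr0 /lin -sumrB.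
congr (`|_| <= _); apply: eq_bigr => i _.
by rewrite ffunE rmorphB /= mulrBl.
Qed.

(** * Integral multiples and integral minimal polynomials *)

Lemma Aint_denominator (z : algC) :
  exists2 d : int, d != 0 & d%:~R * z \in Aint.
Proof.
have [p [_ mon_p] min_p] := minCpolyP z.
have [q [a nz_a Dp]] := rat_poly_scale p.
have qz : root (map_poly intr q) z.
  have : root (map_poly ratr p) z by rewrite min_p.
  rewrite Dp map_polyZ /= rootZ ?fmorph_eq0 ?invr_eq0 ?intr_eq0 //.
  rewrite -map_poly_comp (eq_map_poly (g := intr)) // => c.
  by rewrite /= rmorph_int.
have nz_q : q != 0.
  apply: contraTneq mon_p => q0.
  by rewrite Dp q0 map_poly0 scaler0 monicE lead_coef0 eq_sym oner_eq0.
exists (lead_coef q); first by rewrite lead_coef_eq0.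
set l := lead_coef q; set s := (size q).-1.
have size_q : size q = s.+1 by rewrite prednK // size_poly_gt0.
have s_gt0 : (0 < s)%N.
  have := root_size_gt1 _ qz.
  rewrite map_poly_eq0_id0 ?intr_eq0 ?lead_coef_eq0 //.
  by rewrite size_map_inj_poly ?size_q //; [apply | apply: intr_inj].
(* With q of degree s and leading coefficient l, the polynomial
   l ^ (s - 1) q(X / l) is monic with integer coefficients. *)
pose r : {poly algC} := 'X^s + \poly_(i < s) (q`_i * l ^+ (s.-1 - i))%:~R.
apply: (@root_monic_Aint r); last 2 first.
- rewrite monicE lead_coefDl ?lead_coefXn //.
  by rewrite size_polyXn ltnS size_poly.
- apply/polyOverP => i; rewrite /r coefD coefXn coef_poly rpredD ?rpred_nat //.
  by case: ifP; rewrite ?intr_int ?rpred0.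
rewrite /root /r hornerD hornerXn horner_poly.
move: qz; rewrite /root horner_coef size_map_inj_poly //; last exact: intr_inj.
rewrite size_q big_ord_recr /= => /eqP e.
apply/eqP; have := congr1 (GRing.mul (l%:~R ^+ s.-1)) e.
rewrite mulr0 mulrDr mulr_sumr; apply: etrans; rewrite addrC; congr (_ + _).
  apply: eq_bigr => i _; rewrite coef_map /= exprMn rmorphM rmorphXn /=.
  have le_is : (i <= s.-1)%N by rewrite -ltnS prednK.
  by rewrite -[in RHS](subnK le_is) exprD [RHS]mulrACA [_%:~R * _]mulrC.
by rewrite exprMn coef_map /= /l lead_coefE -/s mulrA -exprSr prednK.
Qed.

(** The roots in the definition of the Mahler measure come from an arbitrary
    factorization; this identifies them with any other list of roots. *)
Lemma perm_complex_roots (p : {poly int}) (s : seq algC) c :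
  c != 0 -> map_poly intr p = c *: \prod_(z <- s) ('X - z%:P) ->
  perm_eq (complex_roots p) s.
Proof.
move=> nz_c Dp; rewrite /complex_roots.
case: closed_field_poly_normal => r /= Dr.
have lc : lead_coef (map_poly intr p : {poly algC}) = c.
  by rewrite Dp lead_coefZ (monicP (monic_prod_XsubC _ _ _)) mulr1.
rewrite lc Dp in Dr; have /(scalerI nz_c) Ers := Dr.
by rewrite prod_XsubC_eq.
Qed.

(** The minimal polynomial of an algebraic integer already has integer
    coefficients, and the content of its integer multiple by c is c times its
    own content; primitivity forces c = 1 or c = -1. *)
Lemma minZpoly_lead_Aint a : a \in Aint -> `|lead_coef (minZpoly a)| = 1.
Proof.
rewrite unfold_in => /floorpP[p Dp].
have Ep : minZpoly a = lead_coef (minZpoly a) *: p.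
  apply: (@map_inj_poly _ algC intr (@intr_inj _)); first by rewrite rmorph0.
  by rewrite map_polyZ /= -Dp minZpolyE.
have := minZpoly_primitive a; rewrite {1}Ep zcontentsZ => e.
have /eqP := congr1 absz e.
by rewrite abszM muln_eq1 => /andP[/eqP lc1 _]; rewrite -abszE lc1.
Qed.

Section GaloisField.

Variables (K : splittingFieldType rat) (iota : {rmorphism K -> algC}).
Hypothesis galK : galois 1%AS {:K}%AS.
Implicit Types (x y u w : K) (g h : gal_of {:K}).

(** * Conjugates, integers and units of a Galois field *)

Lemma mem_gal_base g : g \in 'Gal({:K} / 1)%g.
Proof. by rewrite gal_kHom ?sub1v // k1HomE; exact: valP. Qed.

Lemma card_gal : #|{: gal_of {:K}}| = \dim {:K}.
Proof.
have := galois_dim galK; rewrite dimv1 divn1 => ->.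
by apply/esym/eq_card => g; rewrite inE mem_gal_base.
Qed.

Lemma galX g h x : (g * h)%g x = h (g x).
Proof. by rewrite galM ?memvf. Qed.

Lemma galV_gal g x : (g^-1)%g (g x) = x.
Proof. by rewrite -galX mulgV gal_id. Qed.

Definition conjugates x : seq K :=
  undup [seq (g : gal_of {:K}) x | g : gal_of {:K}].

Lemma uniq_conjugates x : uniq (conjugates x).
Proof. exact: undup_uniq. Qed.

Lemma conjugatesP x y : reflect (exists g, y = g x) (y \in conjugates x).
Proof.
rewrite mem_undup; apply: (iffP mapP) => [[g _ ->]|[g ->]]; first by exists g.
by exists g; rewrite ?mem_enum.
Qed.

(** Maps that commute with the Galois group, such as negation and inversion,
    carry conjugates to conjugates. *)
Lemma perm_conjugates_map (f : K -> K) x :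
  injective f -> (forall g y, g (f y) = f (g y)) ->
  perm_eq (conjugates (f x)) [seq f y | y <- conjugates x].
Proof.
move=> f_inj gf; apply: uniq_perm; rewrite ?map_inj_uniq ?uniq_conjugates //.
move=> y; apply/conjugatesP/mapP => [[g ->]|[_ /conjugatesP[g ->] ->]].
  2: by exists g; rewrite gf.
by exists (g x); [apply/conjugatesP; exists g | rewrite gf].
Qed.

Lemma perm_conjugates_gal g x : perm_eq (conjugates (g x)) (conjugates x).
Proof.
apply: uniq_perm; rewrite ?uniq_conjugates // => y.
apply/conjugatesP/conjugatesP => [[h ->]|[h ->]].
  by exists (g * h)%g; rewrite galX.
by exists (g^-1 * h)%g; rewrite galX galV_gal.
Qed.

Lemma perm_conjugatesV x :
  perm_eq (conjugates x^-1) [seq y^-1 | y <- conjugates x].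
Proof.
by apply: perm_conjugates_map => [|g y]; [exact: invr_inj | rewrite fmorphV].
Qed.

(** As K is Galois, minimal polynomials split in K into distinct linear
    factors. *)
Lemma minPoly_conjugates x :
  minPoly 1 x = \prod_(z <- conjugates x) ('X - z%:P).
Proof.
have /galois_factors := galK.
rewrite sub1v => /(_ isT x (memvf _))[r [_ uniq_r Dp]].
rewrite Dp; apply: perm_big; apply: uniq_perm => //; first exact: undup_uniq.
move=> y; apply/idP/conjugatesP => [/mapP[g _ ->]|[g ->]]; first by exists g.
have := root_minPoly_gal (sub1v _) (mem_gal_base g) (memvf x).
by rewrite Dp root_prod_XsubC.
Qed.

Lemma size_conjugates x : size (conjugates x) = \dim <<1; x>>%VS.
Proof.
have := size_minPoly 1 x.
rewrite minPoly_conjugates // size_prod_XsubC => -[->].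
by rewrite dim_Fadjoin dimv1 muln1.
Qed.

Lemma iota_rat : iota \o in_alg K =1 ratr.
Proof. exact: fmorph_eq_rat. Qed.

Lemma iota_base x : x \in 1%VS -> iota x \in Crat.
Proof.
by case/vlineP=> q ->; have /= -> := iota_rat q; apply/CratP; exists q.
Qed.

Lemma minCpoly_iota x :
  minCpoly (iota x) = \prod_(z <- conjugates x) ('X - (iota z)%:P).
Proof.
have -> : \prod_(z <- conjugates x) ('X - (iota z)%:P)
          = map_poly iota (minPoly 1 x).
  rewrite minPoly_conjugates rmorph_prod; apply: eq_bigr => z _.
  by rewrite /= map_polyXsubC.
have [q Dq] := polyOver1P (minPolyOver 1 x).
have mapE r : map_poly iota (map_poly (in_alg K) r) = map_poly ratr r.
  by rewrite -map_poly_comp; apply: eq_map_poly; apply: iota_rat.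
have [p [Dp mon_p] min_p] := minCpolyP (iota x).
apply/eqP; rewrite -eqp_monic ?minCpoly_monic ?map_monic ?monic_minPoly //.
rewrite Dq mapE Dp; apply/andP; split; rewrite dvdp_map.
  by rewrite -min_p -mapE -Dq fmorph_root root_minPoly.
rewrite -(dvdp_map (in_alg K)) -Dq minPoly_dvdp //.
  by apply/polyOver1P; exists p.
by rewrite -(fmorph_root iota) mapE -Dp root_minCpoly.
Qed.

Lemma iota_gal_minCpoly g x : minCpoly (iota (g x)) = minCpoly (iota x).
Proof.
by rewrite !minCpoly_iota (perm_big _ (perm_conjugates_gal g x)).
Qed.

(** Complex conjugation fixes the rational coefficients of the minimal
    polynomial, hence permutes its roots. *)
Lemma conjugates_conjC x z : z \in conjugates x ->
  exists2 y, y \in conjugates x & iota y = (iota z)^*.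
Proof.
move=> xz; have : root (minCpoly (iota x)) (iota z)^*.
  have [g Dz] := conjugatesP _ _ xz.
  have -> : minCpoly (iota x) = minCpoly (iota z)^*.
    by rewrite minCpoly_aut Dz iota_gal_minCpoly.
  exact: root_minCpoly.
rewrite minCpoly_iota // -(big_map iota xpredT (fun z => 'X - z%:P)).
rewrite root_prod_XsubC.
by case/mapP => y xy ->; exists y.
Qed.

Lemma Aint_gal g x : (iota (g x) \in Aint) = (iota x \in Aint).
Proof. by rewrite !unfold_in iota_gal_minCpoly. Qed.

Lemma in_ring_of_integersE x : in_ring_of_integers x <-> iota x \in Aint.
Proof.
split=> [[p mon_p px]|]; last first.
  rewrite unfold_in => /floorpP[p Dp].
  have mon_p : p \is monic.
    have := minCpoly_monic (iota x); rewrite Dp !monicE.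
    rewrite lead_coef_map_inj //; last exact: intr_inj.
    by rewrite -[X in _ == X -> _]/(1%:~R) eqr_int.
  exists p => //; rewrite -(fmorph_root iota) -map_poly_comp.
  have -> : map_poly (iota \o intr) p = map_poly intr p.
    by apply: eq_map_poly => z; rewrite /= rmorph_int.
  by rewrite -Dp root_minCpoly.
apply: (@root_monic_Aint (map_poly intr p)).
- rewrite -(fmorph_root iota) -map_poly_comp in px.
  rewrite -(eq_map_poly (_ : iota \o intr =1 intr)) // => z.
  by rewrite /= rmorph_int.
- exact: monic_map.
by apply/polyOverP=> i; rewrite coef_map /= intr_int.
Qed.

(** Since 0^-1 = 0, the element 0 satisfies this condition; the nonzero
    elements that do are the units of the ring of integers. *)
Definition biintegral x := (iota x \in Aint) && (iota x^-1 \in Aint).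

Lemma algebraic_unitP x : algebraic_unit x <-> biintegral x /\ x != 0.
Proof.
split=> [[intx [v intv xv]]|[/andP[intx intV] nzx]].
  move: intx intv => /in_ring_of_integersE intx /in_ring_of_integersE intv.
  have nzx : x != 0.
    by apply: contra_eq_neq xv => ->; rewrite mul0r eq_sym oner_eq0.
  split=> //; apply/andP; split=> //.
  by rewrite -[x^-1]mulr1 -xv mulKf.
split; first exact/in_ring_of_integersE.
by exists x^-1; [exact/in_ring_of_integersE | rewrite divff].
Qed.

Lemma biintegralM x y : biintegral x -> biintegral y -> biintegral (x * y).
Proof.
move=> /andP[ix iVx] /andP[iy iVy].
by rewrite /biintegral invfM !rmorphM !rpredM.
Qed.

Lemma biintegralV x : biintegral x^-1 = biintegral x.
Proof. by rewrite /biintegral invrK andbC. Qed.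

Lemma biintegral_gal g x : biintegral (g x) = biintegral x.
Proof. by rewrite /biintegral -fmorphV !Aint_gal. Qed.

Lemma biintegralX x k : biintegral x -> biintegral (x ^+ k).
Proof.
by move=> /andP[ix iVx]; rewrite /biintegral -exprVn !rmorphXn !rpredX.
Qed.

(** All embeddings of K have the same image, because K is normal. *)
Lemma totally_realP : (forall x, iota x \in Num.real) <-> totally_real K.
Proof.
split=> [Rall s x|Rall x]; last exact: Rall.
have : root (map_poly s (minPoly 1 x)) (s x).
  by rewrite fmorph_root root_minPoly.
have [q Dq] := polyOver1P (minPolyOver 1 x).
have -> : map_poly s (minPoly 1 x) = map_poly iota (minPoly 1 x).
  rewrite Dq -!map_poly_comp; apply: eq_map_poly => a.
  by rewrite (fmorph_eq_rat (s \o in_alg K)) iota_rat.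
rewrite minPoly_conjugates // rmorph_prod.
under eq_bigr do rewrite /= map_polyXsubC.
rewrite -(big_map iota xpredT (fun z => 'X - z%:P)) root_prod_XsubC.
by case/mapP => z _ ->.
Qed.

(** * The Mahler measure of integers of a Galois field *)

Lemma mahlerE x : iota x \in Aint ->
  mahler (iota x) = \prod_(z <- conjugates x) Num.max 1 `|iota z|.
Proof.
move=> intx; rewrite /mahler minZpoly_lead_Aint // mul1r.
pose s := [seq iota z | z <- conjugates x].
have nz : (lead_coef (minZpoly (iota x)))%:~R != 0 :> algC.
  by rewrite intr_eq0 lead_coef_eq0 minZpoly_neq0.
rewrite (perm_big s) ?big_map //=.
apply: perm_complex_roots nz _.
by rewrite minZpolyE minCpoly_iota big_map.
Qed.

Lemma mahler_gal g x :
  iota x \in Aint -> mahler (iota (g x)) = mahler (iota x).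
Proof.
move=> intx; rewrite !mahlerE ?Aint_gal //.
by rewrite (perm_big _ (perm_conjugates_gal g x)).
Qed.

Lemma mahler_conjugate x z :
  iota x \in Aint -> z \in conjugates x -> mahler (iota z) = mahler (iota x).
Proof. by move=> intx /conjugatesP[g ->]; apply: mahler_gal. Qed.

Lemma mahlerN x : iota x \in Aint -> mahler (iota (- x)) = mahler (iota x).
Proof.
move=> intx; rewrite !mahlerE ?rmorphN ?rpredN //.
rewrite (perm_big _ (perm_conjugates_map x (@oppr_inj K) _)); last first.
  by move=> g y; rewrite rmorphN.
by rewrite big_map; apply: eq_bigr => z _; rewrite rmorphN normrN.
Qed.

Lemma mahler_norm x : iota x \in Num.real -> iota x \in Aint ->
  mahler `|iota x| = mahler (iota x).
Proof.
move=> Rx intx; have [_|_] := real_ge0P Rx; first by [].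
by rewrite -rmorphN mahlerN.
Qed.

Lemma mahler1 : mahler 1 = 1.
Proof.
rewrite -(rmorph1 iota) mahlerE ?rmorph1 // big1_seq // => z /andP[_].
by move/conjugatesP => [g ->]; rewrite !rmorph1 normr1 maxxx.
Qed.

(** The product of the conjugates is, up to sign, the constant coefficient of
    the minimal polynomial, a nonzero rational integer. *)
Lemma prod_conjugates_ge1 x : iota x \in Aint -> x != 0 ->
  1 <= \prod_(z <- conjugates x) `|iota z|.
Proof.
move=> intx nzx; rewrite -normr_prod.
apply: norm_intr_ge1; last first.
  rewrite prodf_seq_neq0; apply/allP => z /conjugatesP[g ->] /=.
  by rewrite fmorph_eq0 fmorph_eq0.
apply: Cint_rat_Aint; last first.
  rewrite big_seq rpred_prod // => z /conjugatesP[g ->].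
  by rewrite Aint_gal.
rewrite -rmorph_prod; apply: iota_base.
have := rpred_horner (minPolyOver 1 x) (mem0v 1%AS).
rewrite minPoly_conjugates // horner_prod.
under eq_bigr do rewrite hornerXsubC sub0r -mulN1r.
rewrite big_split /= big_const_seq iter_mulr_1 -signr_odd.
case: odd; rewrite ?expr0 ?mul1r //.
by rewrite expr1 mulN1r rpredN.
Qed.

Lemma prod_conjugates1 x : biintegral x -> x != 0 ->
  \prod_(z <- conjugates x) `|iota z| = 1.
Proof.
move=> /andP[intx intVx] nzx.
apply/eqP; rewrite eq_le prod_conjugates_ge1 // andbT.
have := prod_conjugates_ge1 intVx; rewrite invr_eq0 => /(_ nzx).
rewrite (perm_big _ (perm_conjugatesV x)) big_map.
under eq_bigr do rewrite fmorphV normfV.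
rewrite prodfV invf_ge1 //; apply: lt_le_trans ltr01 _.
exact: prod_conjugates_ge1.
Qed.

(** Termwise max(1, 1/a) = max(1, a) / a, and the conjugates of a unit have
    product 1 in absolute value. *)
Lemma mahlerV x : biintegral x -> x != 0 ->
  mahler (iota x^-1) = mahler (iota x).
Proof.
move=> Ux nzx; have /andP[intx intVx] := Ux.
rewrite !mahlerE // (perm_big _ (perm_conjugatesV x)) big_map.
rewrite -[RHS]divr1 -[X in _ / X](prod_conjugates1 Ux nzx).
rewrite -prodfV -big_split /=.
apply: eq_big_seq => z /conjugatesP[g Dz]; rewrite fmorphV normfV.
have z_gt0 : 0 < `|iota z| by rewrite normr_gt0 fmorph_eq0 Dz fmorph_eq0.
rewrite maxr_pMl ?invr_ge0 ?ltW // mul1r divff ?gt_eqF //.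
by rewrite comparable_maxC // real_comparable // ?rpred1 ?rpredV ?normr_real.
Qed.

Lemma mahler_outside x : iota x \in Aint ->
  mahler (iota x) = \prod_(z <- conjugates x | 1 < `|iota z|) `|iota z|.
Proof. by move=> intx; rewrite mahlerE // [RHS]big_mkcond. Qed.

(** * Sextic fields with non-real elements *)

(** A unique conjugate z outside the unit circle must be its own complex
    conjugate, so M(x) = |z| is z or - z, with the same Mahler measure as x. *)
Lemma mahler_outside_le1 x : iota x \in Aint ->
  (count (fun z => 1 < `|iota z|)%R (conjugates x) <= 1)%N ->
  mahler (mahler (iota x)) = mahler (iota x).
Proof.
move=> intx; rewrite -size_filter mahler_outside // -big_filter.
case Ds : [seq _ <- _ | _] => [|z [|]] //= _; first by rewrite big_nil mahler1.
rewrite big_seq1.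
have : z \in [seq z <- conjugates x | 1 < `|iota z|] by rewrite Ds mem_head.
rewrite mem_filter => /andP[z_gt1 xz].
have Rz : iota z \in Num.real.
  have [y xy Dy] := conjugates_conjC xz; rewrite CrealE -Dy.
  have : y \in [seq z <- conjugates x | 1 < `|iota z|].
    by rewrite mem_filter xy Dy norm_conjC z_gt1.
  by rewrite Ds inE => /eqP ->.
have intz : iota z \in Aint.
  by have [g ->] := conjugatesP _ _ xz; rewrite Aint_gal.
rewrite mahler_norm // (mahler_conjugate _ xz) // mahler_outside //.
by rewrite -big_filter Ds big_seq1.
Qed.

(** Among at most three conjugates, at most one is outside the unit circle or
    at most one is inside; inversion swaps the two cases and preserves M. *)
Lemma mahler_cubic x : biintegral x -> x != 0 -> (size (conjugates x) <= 3)%N ->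
  mahler (mahler (iota x)) = mahler (iota x).
Proof.
move=> Ux nzx sz; have /andP[intx intVx] := Ux.
pose outer z := 1 < `|iota z|.
have [le1|gt1] := leqP (count outer (conjugates x)) 1.
  exact: mahler_outside_le1.
rewrite -mahlerV //; apply: mahler_outside_le1 => //.
rewrite (seq.permP (perm_conjugatesV x)) count_map.
have : (count (preim (fun z => z^-1) outer) (conjugates x)
        <= count (predC outer) (conjugates x))%N.
  apply: sub_count => z; rewrite /outer /= fmorphV normfV.
  case: (eqVneq z 0) => [->|nz]; first by rewrite rmorph0 normr0 invr0 ltr10.
  by rewrite invf_gt1 ?normr_gt0 ?fmorph_eq0 // => h; rewrite lt_gtF.
move/leq_trans; apply; rewrite -(leq_add2l (count outer (conjugates x))).
by rewrite count_predC; apply: leq_trans sz _; rewrite addn1 ltnS.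
Qed.

(** Elements of Q(x) are polynomials in x with rational coefficients. *)
Lemma real_adjoin x y : iota x \in Num.real -> y \in <<1; x>>%VS ->
  iota y \in Num.real.
Proof.
move=> Rx /Fadjoin1_polyP[q ->]; rewrite -horner_map -map_poly_comp /=.
apply: rpred_horner => //; apply/polyOverP => i; rewrite coef_map.
by apply: Creal_Crat; have /= -> := iota_rat q`_i; apply/CratP; exists q`_i.
Qed.

Lemma size_conjugates_real x y : \dim {:K} = 6%N -> iota x \in Num.real ->
  iota y \notin Num.real -> (size (conjugates x) <= 3)%N.
Proof.
move=> dimK Rx nRy; rewrite size_conjugates.
have dv : (\dim <<1; x>> %| 6)%N by rewrite -dimK field_dimS ?subvf.
have neq : \dim <<1; x>>%VS != 6%N.
  apply: contraNneq nRy => dim6; apply: (real_adjoin Rx).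
  suffices -> : <<1; x>>%VS = {:K}%VS by rewrite memvf.
  by apply/eqP; rewrite eqEdim subvf dimK dim6.
have := dvdn_leq (isT : 0 < 6)%N dv; move: dv neq.
by case: (\dim _) => [|[|[|[|[|[|[|]]]]]]].
Qed.

(** The product p of the conjugates outside the unit circle lies in K, and
    complex conjugation permutes its factors; M(x) is p or - p. *)
Lemma mahler_real_unit x : biintegral x -> x != 0 ->
  exists w, [/\ biintegral w, w != 0, iota w \in Num.real
    & mahler (iota x) = iota w].
Proof.
move=> /andP[intx intVx] nzx.
pose p := \prod_(z <- conjugates x | 1 < `|iota z|) z.
have nzp : p != 0.
  rewrite /p -big_filter prodf_seq_neq0; apply/allP => z.
  by rewrite mem_filter => /andP[_ /conjugatesP[g ->]]; rewrite /= fmorph_eq0.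
have Up : biintegral p.
  rewrite /biintegral fmorphV /p rmorph_prod -prodfV.
  rewrite big_seq_cond [X in _ && (X \in _)]big_seq_cond.
  rewrite !rpred_prod // => _ /andP[/conjugatesP[g ->] _].
    by rewrite -fmorphV -fmorphV Aint_gal.
  by rewrite Aint_gal.
have Rp : iota p \in Num.real.
  rewrite CrealE /p rmorph_prod -(big_map iota (fun z => 1 < `|z|) id) /=.
  set s := map _ _; rewrite rmorph_prod.
  have -> : \prod_(z <- s | 1 < `|z|) z^*
            = \prod_(z <- map Num.conj s | 1 < `|z|) z.
    by rewrite big_map; apply: eq_bigl => z; rewrite norm_conjC.
  apply/eqP; apply: perm_big; have uniq_s : uniq s.
    by rewrite map_inj_uniq ?uniq_conjugates //; apply: fmorph_inj.
  have sub z : z \in s -> z^* \in s.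
    case/mapP => y /conjugates_conjC[y' y's Dy] ->.
    by rewrite -Dy map_f.
  apply: uniq_perm; rewrite ?(map_inj_uniq (can_inj conjCK)) //.
  move=> z; apply/mapP/idP => [[y sy ->]|sz]; first exact: sub.
  by exists z^*; rewrite ?conjCK //; apply: sub.
have Mx : mahler (iota x) = `|iota p|.
  by rewrite mahler_outside // /p rmorph_prod normr_prod.
have [p_ge0|p_lt0] := real_ge0P Rp; rewrite Mx.
  by exists p; split=> //; rewrite ger0_norm.
exists (- p); rewrite rmorphN rpredN oppr_eq0; split=> //.
  2: by rewrite ltr0_norm.
by move: Up; rewrite /biintegral invrN !rmorphN !rpredN.
Qed.

(** After one step the orbit is at a real unit, of degree at most 3 because K
    has non-real elements; one more step reaches a fixed point of M. *)
Lemma not_wandering x y : \dim {:K} = 6%N -> iota y \notin Num.real ->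
  biintegral x -> x != 0 -> ~ wandering (iota x).
Proof.
move=> dimK nRy Ux nzx; apply; apply: (@iter_idem_finite _ _ _ 2) => /=.
have [w [Uw nzw Rw ->]] := mahler_real_unit Ux nzx.
exact: mahler_cubic (size_conjugates_real dimK Rw nRy).
Qed.

(** * Norms and integral lattices *)

Definition gal_norm x : algC := \prod_g iota ((g : gal_of {:K}) x).

Lemma gal_norm_int x : iota x \in Aint -> gal_norm x \in Num.int.
Proof.
move=> intx; apply: Cint_rat_Aint; last first.
  by apply: rpred_prod => g _; rewrite Aint_gal.
suffices -> : gal_norm x = iota (galNorm 1%AS {:K} x).
  by apply: iota_base; apply: mem_galNorm galK (memvf x).
by rewrite /galNorm rmorph_prod; apply: eq_bigl => g; rewrite mem_gal_base.
Qed.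

Lemma gal_norm_unit x : biintegral x -> x != 0 -> `|gal_norm x| = 1.
Proof.
move=> /andP[intx intVx] nzx.
have ge1 y : y != 0 -> iota y \in Aint -> 1 <= `|gal_norm y|.
  move=> nzy inty; apply: norm_intr_ge1; first exact: gal_norm_int.
  by apply/prodf_neq0 => g _; rewrite !fmorph_eq0.
apply/eqP; rewrite eq_le ge1 // andbT.
have := ge1 _ _ intVx; rewrite invr_eq0 => /(_ nzx).
have -> : gal_norm x^-1 = (gal_norm x)^-1.
  by rewrite /gal_norm -prodfV; apply: eq_bigr => g _; rewrite !fmorphV.
rewrite normfV invf_ge1 //; apply: lt_le_trans ltr01 _; exact: ge1.
Qed.

(** The element x divides its norm, the cofactor being the product of the other
    conjugates, and the norm divides C!. *)
Lemma fact_div_Aint x C : iota x \in Aint -> x != 0 -> `|gal_norm x| <= C%:R ->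
  (C`!)%:R / iota x \in Aint.
Proof.
move=> intx nzx leC; have [N DN] := intrP (gal_norm_int intx).
have nz_ix : iota x != 0 by rewrite fmorph_eq0.
have nzN : N != 0.
  rewrite -(intr_eq0 algC) -DN; apply/prodf_neq0 => g _.
  by rewrite !fmorph_eq0.
have /dvdzP[k Dk] : (N %| C`!%:Z)%Z.
  rewrite dvdzE; apply: dvdn_fact.
  rewrite absz_gt0 nzN -lez_nat abszE -(ler_int algC).
  by rewrite intr_norm -DN.
have -> : (C`!)%:R = k%:~R * gal_norm x by rewrite DN -rmorphM /= -Dk.
rewrite -mulrA rpredM ?Aint_int // /gal_norm (bigD1 1%g) //= gal_id.
rewrite mulrAC mulfV // mul1r.
by apply: rpred_prod => g _; rewrite Aint_gal.
Qed.

Local Notation n := (\dim {:K}).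

Definition int_comb (b : 'I_n -> K) (c : {ffun 'I_n -> int}) : K :=
  \sum_i (c i)%:~R * b i.

(** Scaling a basis of K over the rationals makes its elements integral. *)
Lemma integral_basis : exists b : 'I_n -> K,
  (forall i, iota (b i) \in Aint) /\
  forall c, int_comb b c = 0 -> forall i, c i = 0.
Proof.
pose X := vbasis {:K}.
have [d dP] := choice (fun i : 'I_n =>
  let: ex_intro2 d d0 dA := Aint_denominator (iota X`_i) in
  ex_intro (fun d : int => d != 0 /\ d%:~R * iota X`_i \in Aint)
    d (conj d0 dA)).
exists (fun i => (d i)%:~R * X`_i); split=> [i|c c0 i].
  by rewrite rmorphM rmorph_int; have [] := dP i.
have [nzd _] := dP i.
have /freeP/(_ (fun i => (c i * d i)%:~R)) := basis_free (vbasisP {:K}).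
have -> : \sum_(i < n) (c i * d i)%:~R *: X`_i
          = int_comb (fun i => (d i)%:~R * X`_i) c.
  apply: eq_bigr => j _; rewrite mulrA -rmorphM /= -[RHS]/((c j * d j)%:~R * _).
  by rewrite -mulr_algl scaler_int.
move/(_ c0 i)/eqP; rewrite intr_eq0 mulf_eq0 (negPf nzd) orbF.
by move/eqP.
Qed.

(** * Units with small conjugates in totally real fields *)

Hypothesis Kreal : forall x, iota x \in Num.real.

Section IntegralLattice.

Variable b : 'I_n -> K.
Hypothesis int_b : forall i, iota (b i) \in Aint.
Hypothesis free_b : forall c, int_comb b c = 0 -> forall i, c i = 0.

Lemma Aint_int_comb c : iota (int_comb b c) \in Aint.
Proof.
rewrite rmorph_sum rpred_sum // => i _.
by rewrite rmorphM rmorph_int rpredM ?Aint_int.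
Qed.

Lemma int_combB (c c' : {ffun 'I_n -> int}) :
  int_comb b [ffun i => c i - c' i] = int_comb b c - int_comb b c'.
Proof.
rewrite /int_comb -sumrB; apply: eq_bigr => i _.
by rewrite ffunE rmorphB mulrBl.
Qed.

(** The box principle is applied to the embeddings other than iota. With a
    bound A / q at each of these n - 1 embeddings, and a bound at iota itself
    that grows like the power n - 1 of q, the norm stays bounded. *)
Lemma small_lattice_element : exists C : nat, forall x, x != 0 -> exists c,
  [/\ int_comb b c != 0, `|gal_norm (int_comb b c)| <= C%:R &
      forall g, g != 1%g -> `|iota (g (int_comb b c))| < `|iota (g x)|].
Proof.
pose J := {g : gal_of {:K} | g != 1%g}.
pose L (j : J) (i : 'I_n) := iota (sval j (b i)).
pose S : algC := \sum_g \sum_i `|iota ((g : gal_of {:K}) (b i))|.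
have S_ge0 : 0 <= S by do 2![apply: sumr_ge0 => ? _]; apply: normr_ge0.
pose B := Num.bound S.
have leB g : \sum_i `|iota (g (b i))| <= B%:R.
  apply: le_trans (ltW (archi_boundP S_ge0)).
  rewrite /S (bigD1 g) //= lerDl.
  by do 2![apply: sumr_ge0 => ? _]; apply: normr_ge0.
have cardJ : #|'I_n| = #|{: J}|.+1.
  rewrite card_ord -card_gal card_sig (cardD1 1%g) inE add1n; congr _.+1.
  by apply: eq_card => g; rewrite !inE andbT.
exists ((2 * B).+1 ^ n)%N => x nzx.
pose q := (\max_g Num.bound ((2 * B).+1%:R / `|iota ((g : gal_of {:K}) x)|)).+1.
have gx_gt0 g : 0 < `|iota (g x)| by rewrite normr_gt0 !fmorph_eq0.
have q_big g : (2 * B).+1%:R / q%:R < `|iota (g x)|.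
  rewrite ltr_pdivrMr ?ltr0n // mulrC -ltr_pdivrMr //.
  apply: lt_trans (archi_boundP _) _; first by rewrite divr_ge0 ?ler0n ?ltW.
  by rewrite ltr_nat ltnS; apply: (leq_bigmax g).
have RL (j : J) i : L j i \is Num.real by exact: Kreal.
have [c [[i nz_ci] c_le c_small]] :=
  small_combination RL (fun j => leB (sval j)) cardJ (ltn0Sn _ : 0 < q)%N.
have gzE g : iota (g (int_comb b c)) = \sum_i (c i)%:~R * iota (g (b i)).
  by rewrite !rmorph_sum; apply: eq_bigr => k _; rewrite !rmorphM !rmorph_int.
have g_small g : g != 1%g ->
    `|iota (g (int_comb b c))| <= (2 * B).+1%:R / q%:R.
  by move=> g1; rewrite gzE; apply: (c_small (exist _ g g1)).
exists c; split.
- by apply: contraNneq nz_ci => /free_b ->.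
- rewrite /gal_norm normr_prod (bigD1 1%g) //=.
  apply: le_trans (_ : (q ^ #|{: J}| * B)%:R *
    \prod_(g : gal_of {:K} | g != 1%g) ((2 * B).+1%:R / q%:R) <= _).
    apply: ler_pM; rewrite ?normr_ge0 ?prodr_ge0 //.
      rewrite gzE (le_trans (ler_norm_sum _ _ _)) // natrM.
      apply: le_trans (ler_wpM2l (ler0n _ _) (leB 1%g)); rewrite mulr_sumr.
      apply: ler_sum => k _; rewrite normrM ler_wpM2r // -intr_norm -abszE.
      by rewrite -pmulrn ler_nat.
    by apply: ler_prod => g g1; rewrite normr_ge0 g_small.
  rewrite prodr_const -[n]card_ord cardJ card_sig; set m := #|_|.
  rewrite natrM natrX exprMn exprVn mulrAC mulrCA mulfV ?mulr1 //; last first.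
    by rewrite expf_neq0 ?pnatr_eq0.
  rewrite natrX exprS mulrC ler_wpM2r ?exprn_ge0 ?ler0n //.
  by rewrite ler_nat -addn1 mul2n -addnn -addnA leq_addr.
by move=> g g1; apply: le_lt_trans (q_big g); apply: g_small.
Qed.

(** If x and y are the two combinations, y = x + C! z with z in the lattice, so
    y / x = 1 + (C! / x) z. *)
Lemma congr_quotient_Aint C (c c' : {ffun 'I_n -> int}) :
  int_comb b c != 0 -> `|gal_norm (int_comb b c)| <= C%:R ->
  (forall i, (c' i = c i %[mod C`!%:Z])%Z) ->
  iota (int_comb b c' / int_comb b c) \in Aint.
Proof.
move=> nz le_C eq_cc; pose e := [ffun i => ((c' i - c i) %/ C`!%:Z)%Z].
have -> : int_comb b c' = int_comb b c + (C`!)%:R * int_comb b e.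
  apply/eqP; rewrite -subr_eq0 opprD addrA subr_eq0 -int_combB; apply/eqP.
  rewrite [RHS]mulr_sumr; apply: eq_bigr => i _; rewrite !ffunE mulrA.
  have /divzK {1}<- : (C`!%:Z %| (c' i - c i)%R)%Z.
    by rewrite -eqz_mod_dvd eq_cc.
  by rewrite rmorphM /= [_%:~R * _%:~R]mulrC.
rewrite mulrDl divff // mulrAC rmorphD rmorph1 rmorphM rpredD ?Aint1 //.
rewrite rpredM ?Aint_int_comb // rmorphM fmorphV rmorph_nat.
by apply: fact_div_Aint => //; apply: Aint_int_comb.
Qed.

(** Iterating [small_lattice_element] keeps the same bound C on the norms, and
    gives the quotient of a later term by an earlier one absolute value < 1 at
    every embedding other than iota. *)
Lemma shrinking_lattice_sequence :
  exists C : nat, exists s : nat -> {ffun 'I_n -> int},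
  [/\ forall k, int_comb b (s k) != 0,
      forall k, `|gal_norm (int_comb b (s k))| <= C%:R &
      forall g, g != 1%g ->
        {homo (fun k => `|iota (g (int_comb b (s k)))|) :
          k l / (k < l)%N >-> l < k}].
Proof.
have [C stepC] := small_lattice_element; exists C.
have [F FP] : {F : K -> {ffun 'I_n -> int} | forall x, x != 0 ->
    [/\ int_comb b (F x) != 0, `|gal_norm (int_comb b (F x))| <= C%:R &
      forall g, g != 1%g -> `|iota (g (int_comb b (F x)))| < `|iota (g x)|]}.
  apply: cid; have /choice[F FP] : forall x, exists c, x != 0 ->
    [/\ int_comb b c != 0, `|gal_norm (int_comb b c)| <= C%:R &
      forall g, g != 1%g -> `|iota (g (int_comb b c))| < `|iota (g x)|].
    move=> x; have [->|/stepC[c cP]] := eqVneq x 0; last by exists c.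
    by exists [ffun=> 0].
  by exists F.
pose s k := iter k (fun c => F (int_comb b c)) (F 1).
have s_nz k : int_comb b (s k) != 0.
  by elim: k => [|k /FP[]//]; have [] := FP _ (oner_neq0 _).
exists s; split=> // [[|k]|g g1].
- by have [] := FP _ (oner_neq0 _).
- by have [] := FP _ (s_nz k).
apply: homo_ltn => [y x z yx zy|k]; first exact: lt_trans yx.
by have [_ _ ->] := FP _ (s_nz k).
Qed.

(** Applying [congr_quotient_Aint] to two congruent terms of a shrinking
    sequence, in both orders, shows that their quotient and its inverse are
    integral. *)
Lemma lattice_dirichlet_unit :
  exists x, [/\ biintegral x, x != 0 & forall g, g != 1%g -> `|iota (g x)| < 1].
Proof.
have [C [s [s_nz s_le s_dec]]] := shrinking_lattice_sequence.
(* There are D ^ n residues of coefficient vectors, so two among the first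
   D ^ n + 1 terms of the sequence are congruent. *)
pose D := C`!; have D_gt0 : (0 < D)%N := fact_gt0 C.
have D_nz : D%:Z != 0 by rewrite -lt0n.
have res_lt k i : (`|(s k i %% D%:Z)%Z| < D)%N.
  by rewrite -ltz_nat gez0_abs ?modz_ge0 // ltz_pmod.
pose res (k : 'I_(D ^ n).+1) := [ffun i => Ordinal (res_lt k i)].
have : ~~ injectiveb res.
  apply/injectiveP => /leq_card; rewrite card_ffun !card_ord.
  by rewrite ltnn.
case/injectivePn => k [l neq_kl /ffunP eq_kl].
have {}eq_kl i : (s k i = s l i %[mod D%:Z])%Z.
  have := congr1 val (eq_kl i); rewrite !ffunE /= => /(congr1 Posz).
  by rewrite !gez0_abs ?modz_ge0.
wlog lt_kl : k l neq_kl eq_kl / (k < l)%N.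
  move=> IH; have [lt_kl|lt_lk|/val_inj eq_kl'] := ltngtP k l.
  - exact: IH lt_kl.
  - by apply: (IH l k) => [|i|]; [rewrite eq_sym | rewrite eq_kl | ].
  by rewrite eq_kl' eqxx in neq_kl.
exists (int_comb b (s l) / int_comb b (s k)); split.
- rewrite /biintegral invf_div.
  by rewrite !(congr_quotient_Aint (C := C)) // => i; rewrite eq_kl.
- by rewrite mulf_neq0 ?invr_eq0 ?s_nz.
move=> g g1; rewrite !rmorphM !fmorphV normrM normfV ltr_pdivrMr ?mul1r.
  exact: s_dec.
by rewrite normr_gt0 !fmorph_eq0 s_nz.
Qed.

End IntegralLattice.

(** The half of Dirichlet's unit theorem that produces units: all conjugates
    but one are small, so the remaining one is large. *)
Lemma dirichlet_unit :
  exists x,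
    [/\ biintegral x, x != 0 & forall g, g != 1%g -> `|iota (g x)| < 1].
Proof.
have [b [int_b free_b]] := integral_basis.
exact: lattice_dirichlet_unit int_b free_b.
Qed.

(** * Hexagonal units *)

Section HexagonalUnits.

Hypothesis dimK : \dim {:K} = 6%N.

Variables r t : gal_of {:K}.
Hypotheses (or3 : #[r]%g = 3%N) (ot2 : #[t]%g = 2%N).

Definition rotation_norm x := \prod_(h in <[r]>%g) (h : gal_of {:K}) x.

Lemma t_notin_rotations : t \notin <[r]>%g.
Proof. by apply/negP => /order_dvdG; rewrite ot2 -orderE or3. Qed.

Lemma t_involutive x : t (t x) = x.
Proof. by rewrite -galX -expg2 -ot2 expg_order gal_id. Qed.

Lemma rotations_normal : (<[r]> <| [set: gal_of {:K}])%g.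
Proof.
have sRG : <[r]>%g \subset [set: gal_of {:K}]%g.
  by apply/subsetP => g _; rewrite inE.
apply: (@index2_normal _ [set: gal_of {:K}]%G) => //.
by rewrite -divgS // cardsT card_gal // dimK -orderE or3.
Qed.

Lemma gal_coset : [set: gal_of {:K}] = (<[r]> :|: t *: <[r]>)%g.
Proof.
apply/esym/eqP; rewrite eqEcard subsetT cardsT card_gal // dimK.
rewrite cardsU card_lcoset.
rewrite -!orderE or3 (_ : _ :&: _ = finset.set0) ?cards0 //.
apply/setP => g; rewrite !inE mem_lcoset; apply/negP => /andP[rg].
by rewrite groupMr // groupV (negPf t_notin_rotations).
Qed.

Lemma big_gal (F : gal_of {:K} -> algC) :
  \prod_g F g = \prod_(h in <[r]>%g) (F h * F (t * h)%g).
Proof.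
rewrite (bigID (mem <[r]>%g)) big_split /=; congr (_ * _).
rewrite (reindex_inj (mulgI t)); apply: eq_bigl => h.
have := in_setT (t * h)%g; rewrite gal_coset inE mem_lcoset mulKg.
have [Rh _|_] := boolP (h \in <[r]>%g).
  by rewrite groupMr ?t_notin_rotations.
by rewrite orbF => ->.
Qed.

Lemma rotation_normM x y :
  rotation_norm (x * y) = rotation_norm x * rotation_norm y.
Proof. by rewrite -big_split; apply: eq_bigr => h _; rewrite rmorphM. Qed.

Lemma rotation_normV x : rotation_norm x^-1 = (rotation_norm x)^-1.
Proof. by rewrite -prodfV; apply: eq_bigr => h _; rewrite fmorphV. Qed.

Lemma rotation_norm_neq0 x : x != 0 -> rotation_norm x != 0.
Proof. by move=> nzx; apply/prodf_neq0 => h _; rewrite fmorph_eq0. Qed.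

Lemma rotation_normX x k : rotation_norm (x ^+ k) = rotation_norm x ^+ k.
Proof. by rewrite -prodrXl; apply: eq_bigr => h _; rewrite rmorphXn. Qed.

Lemma rotation_norm_r x : rotation_norm (r x) = rotation_norm x.
Proof.
rewrite /rotation_norm [RHS](reindex_inj (mulgI r)); apply: eq_big => [h|h _].
  by rewrite groupMl ?cycle_id.
by rewrite galX.
Qed.

(** Conjugation by t permutes the rotations, as their group has index 2. *)
Lemma rotation_norm_t x : rotation_norm (t x) = t (rotation_norm x).
Proof.
rewrite /rotation_norm rmorph_prod (reindex_inj (conjg_inj t)).
have /andP[_ /subsetP/(_ t (in_setT _)) Nt] := rotations_normal.
apply: eq_big => [h|h _]; first by rewrite memJ_norm.
by rewrite -galX -conjgC galX.
Qed.

(** The conjugates of w are h w and (h w)^-1 for the three rotations h. *)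
Definition hexagonal w := [/\ t w = w^-1, rotation_norm w = 1 & `|iota w| != 1].

(** The element is x raised to the power (1 - t)(1 - r) of the group ring: the
    factor 1 - t makes t act by inversion, and 1 - r is annihilated by 1 + r +
    r ^ 2, which commutes with t. *)
Lemma hexagonal_unit_exists : exists w, [/\ biintegral w, w != 0 & hexagonal w].
Proof.
have [x [Ux nzx x_lt1]] := dirichlet_unit.
exists (x * t (r x) / (r x * t x)).
have nz g : g x != 0 by rewrite fmorph_eq0.
split; last split.
- by rewrite !(biintegralM, biintegralV, biintegral_gal).
- by rewrite !mulf_neq0 ?invr_eq0 ?mulf_neq0 ?fmorph_eq0.
- rewrite rmorphM fmorphV !rmorphM /= !t_involutive invf_div.
  by rewrite [t x * _]mulrC [t _ * x]mulrC.
- rewrite rotation_normM rotation_normV !rotation_normM.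
  rewrite !rotation_norm_t !rotation_norm_r mulfV //.
  by rewrite mulf_neq0 ?fmorph_eq0 ?rotation_norm_neq0.
have nz_iota g : 0 < `|iota (g x)| by rewrite normr_gt0 fmorph_eq0.
have r_neq1 : r != 1%g by apply/eqP => r1; move: or3; rewrite r1 order1.
have t_neq1 : t != 1%g by apply/eqP => t1; move: ot2; rewrite t1 order1.
have rt_neq1 : (r * t)%g != 1%g.
  apply: contra t_notin_rotations => /eqP/(canRL (mulKg r)) ->.
  by rewrite mulg1 groupV cycle_id.
apply/eqP; rewrite rmorphM fmorphV !rmorphM normrM normfV !normrM.
move/(canRL (divfK _)); rewrite mul1r mulf_neq0 ?gt_eqF // => /(_ isT) eq_prod.
(* If |w| = 1 then |x| |t (r x)| = |r x| |t x| < 1; but the product of all |g x|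
   is 1, and its factors other than |x| and |t (r x)| are at most 1. *)
have := gal_norm_unit Ux nzx; rewrite /gal_norm normr_prod.
rewrite (bigD1 1%g) //= (bigD1 (r * t)%g) //= gal_id galX mulrA eq_prod.
move=> prod1.
have : `|iota (r x)| * `|iota (t x)| < 1.
  by rewrite mulr_ilt1 ?normr_ge0 ?x_lt1.
suff : 1 <= `|iota (r x)| * `|iota (t x)|.
  by move/le_lt_trans/[apply]; rewrite ltxx.
rewrite -[leLHS]prod1 ler_piMr ?mulr_ge0 ?normr_ge0 //.
by apply: prod_le1 => g /andP[g1 _]; rewrite normr_ge0 ltW // x_lt1.
Qed.

Lemma hexagonalX w k : (0 < k)%N -> hexagonal w -> hexagonal (w ^+ k).
Proof.
move=> k_gt0 [tw Nw w1]; split; first by rewrite rmorphXn /= tw exprVn.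
  by rewrite rotation_normX Nw expr1n.
by rewrite rmorphXn normrX pexpr_eq1 ?normr_ge0.
Qed.

Lemma norm_root_of_unity x k : (0 < k)%N -> x ^+ k = 1 -> `|iota x| = 1.
Proof.
move=> k_gt0 /(congr1 iota); rewrite rmorphXn rmorph1 => /(congr1 Num.norm).
by rewrite normrX normr1 => /eqP; rewrite pexpr_eq1 ?normr_ge0 // => /eqP.
Qed.

Lemma hexagonal_stab w g : w != 0 -> hexagonal w -> g w = w -> g = 1%g.
Proof.
move=> nzw [tw Nw w1] gw; have := in_setT g; rewrite gal_coset inE mem_lcoset.
have [//|g1] := eqVneq g 1%g.
case/orP => [Rg|Rg].
  have Eg : <[g]>%g = <[r]>%g.
    apply/eqP; rewrite eqEcard cycle_subG Rg /= -!orderE or3.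
    have := order_dvdG Rg; rewrite -orderE or3 dvdn_divisors // !inE.
    by case/orP => [|/eqP-> //]; rewrite order_eq1 (negPf g1).
  (* A nontrivial rotation fixing w generates all rotations, so that the
     rotation norm of w is w ^+ 3. *)
  case/eqP: w1; apply: (@norm_root_of_unity w 3) => //.
  rewrite -Nw /rotation_norm -Eg big_cycle3 ?gal_id ?galX ?gw //.
  by rewrite orderE Eg -orderE.
(* If t * h fixes w, then h inverts w; as h has order dividing 3, w = w^-1. *)
case/eqP: w1; apply: (@norm_root_of_unity w 2) => //.
have [h Rh Dg] : exists2 h, h \in <[r]>%g & g = (t * h)%g.
  by exists (t^-1 * g)%g; rewrite ?mulKVg.
have hVw : h w^-1 = w by rewrite -tw -galX -Dg.
have hw : h w = w^-1 by rewrite -[LHS]invrK -fmorphV /= hVw.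
have h3 : (h * (h * h))%g = 1%g.
  have := order_dvdG Rh; rewrite -orderE or3 order_dvdn => /eqP <-.
  by rewrite !expgS expg0 mulg1.
have : (h * (h * h))%g w = w by rewrite h3 gal_id.
by rewrite !galX hw hVw hw => wV; rewrite expr2 -{1}wV mulVf.
Qed.

Lemma hexagonal_inj w : w != 0 -> hexagonal w -> injective (fun g => g w).
Proof.
move=> nzw hex_w g h /= e; apply/eqP; rewrite eq_mulgV1; apply/eqP.
by apply: (hexagonal_stab nzw hex_w); rewrite galX e galV_gal.
Qed.

Lemma mahler_hexagonal w : biintegral w -> w != 0 -> hexagonal w ->
  mahler (iota w) = \prod_g Num.max 1 `|iota ((g : gal_of {:K}) w)|.
Proof.
move=> /andP[intw _] nzw hex_w.
rewrite mahlerE // /conjugates undup_id; last first.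
  by rewrite map_inj_uniq ?enum_uniq //; apply: hexagonal_inj hex_w.
by rewrite big_map big_enum.
Qed.

Lemma mahler_hexagonalX w k :
  biintegral w -> w != 0 -> hexagonal w -> (0 < k)%N ->
  mahler (iota (w ^+ k)) = mahler (iota w) ^+ k.
Proof.
move=> Uw nzw hex_w k_gt0.
rewrite !mahler_hexagonal ?biintegralX ?expf_neq0 //; last exact: hexagonalX.
rewrite -prodrXl; apply: eq_bigr => g _; rewrite !rmorphXn normrX !max1_if.
by rewrite expr_gt1 ?normr_ge0 -?lt0n //; case: ifP; rewrite ?expr1n.
Qed.

(** One of w and its conjugate w^-1 lies outside the unit circle. *)
Lemma mahler_hexagonal_gt1 w : biintegral w -> w != 0 -> hexagonal w ->
  1 < mahler (iota w).
Proof.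
move=> Uw nzw hex_w; have [tw _ w1] := hex_w.
rewrite mahler_hexagonal // big_gal (bigD1 1%g) ?group1 //= mulg1 gal_id tw.
rewrite fmorphV normfV max1_mul_max1V; last by rewrite normr_gt0 fmorph_eq0.
apply: lt_le_trans
  (_ : (if 1 < `|iota w| then `|iota w| else `|iota w|^-1) <= _).
  case: ifP => // /negbT; rewrite -real_leNgt ?rpred1 ?normr_real // => le1.
  by rewrite invf_gt1 ?normr_gt0 ?fmorph_eq0 // lt_neqAle w1.
rewrite ler_peMr //; first by case: ifP; rewrite ?invr_ge0 normr_ge0.
by apply: prod_ge1 => g _; rewrite -[leLHS]mulr1 ler_pM ?max1_ge1 ?ler01.
Qed.

(** Pairing h w with its inverse turns the Mahler measure into the product of
    three factors treated by [hexagon_max]. *)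
Lemma mahler_hexagonal_sqr w : biintegral w -> w != 0 -> hexagonal w ->
  exists g, mahler (iota w) = `|iota (g w)| ^+ 2.
Proof.
move=> Uw nzw hex_w; have [tw Nw _] := hex_w.
have := mahler_hexagonal_gt1 Uw nzw hex_w.
have -> : mahler (iota w) = \prod_(h in <[r]>%g)
    (Num.max 1 `|iota (h w)| * Num.max 1 `|iota (h w)|^-1).
  rewrite mahler_hexagonal // big_gal; apply: eq_bigr => h _.
  by rewrite galX tw !fmorphV normfV.
have gt0 g : 0 < `|iota (g w)| by rewrite normr_gt0 !fmorph_eq0.
have gV g : `|iota (g w)|^-1 = `|iota ((t * g)%g w)|.
  by rewrite galX tw !fmorphV normfV.
rewrite big_cycle3 // => gt1.
have [|v v_in ->] := hexagon_max (gt0 1%g) (gt0 r) (gt0 (r * r)%g) _ gt1.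
  rewrite -!normrM -!rmorphM.
  by move: Nw; rewrite /rotation_norm big_cycle3 // => ->; rewrite rmorph1 normr1.
move: v_in; rewrite !gV !inE.
by do ![case/orP]; move/eqP ->; eexists.
Qed.

(** Since M(w) ^ (2 ^ k) = |z| ^ (2 ^ (k + 1)) for a conjugate z of w, and M
    depends neither on the sign nor on the choice of a conjugate, the next
    iterate is M(w ^ (2 ^ (k + 1))). *)
Lemma iter_mahler_hexagonal w k :
  biintegral w -> w != 0 -> hexagonal w ->
  iter k.+1 mahler (iota w) = mahler (iota w) ^+ (2 ^ k).
Proof.
move=> Uw nzw hex_w; elim: k => [//|k IH]; rewrite iterS IH.
have [g Mw] := mahler_hexagonal_sqr Uw nzw hex_w.
rewrite {1}Mw -exprM -expnS -normrX -!rmorphXn.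
have Uwk := biintegralX (2 ^ k.+1) Uw; have /andP[intwk _] := Uwk.
rewrite mahler_norm ?Kreal ?Aint_gal // mahler_gal //.
by rewrite mahler_hexagonalX // expn_gt0.
Qed.

Lemma hexagonal_wandering w : biintegral w -> w != 0 -> hexagonal w ->
  wandering (iota w).
Proof.
move=> Uw nzw hex_w; set M := mahler (iota w).
apply: (@sub_infinite_set _ (range (fun k => M ^+ (2 ^ k)))).
  by move=> _ [k _ <-]; exists k.+1; rewrite //= -iterS iter_mahler_hexagonal.
apply: infinite_range => k l; have M1 := mahler_hexagonal_gt1 Uw nzw hex_w.
move/(ieexprIn (lt_trans ltr01 M1)); rewrite gt_eqF // => /(_ isT).
exact: expnI.
Qed.

End HexagonalUnits.

End GaloisField.

(** * Wandering units and totally real sextic fields *)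

(* The embedding iota presents K as a subfield of algC. *)
Theorem proposition5p3 (K : splittingFieldType rat)
    (iota : {rmorphism K -> algC}) :
  galois 1%AS {:K}%AS -> \dim {:K}%VS = 6%N ->
  (exists2 u : K, algebraic_unit u & wandering (iota u)) <-> totally_real K.
Proof.
move=> galK dimK; split=> [[u /(algebraic_unitP iota)[Uu nzu] wu]|].
  apply/(totally_realP iota galK) => y; apply/negPn/negP => nRy.
  exact: (not_wandering galK dimK nRy Uu nzu wu).
move/(totally_realP iota galK) => Kreal.
have cardG : #|[set: gal_of {:K}]| = 6%N by rewrite cardsT card_gal.
have [//||r _ or3] := @Cauchy _ 3 [set: gal_of {:K}]%G; first by rewrite cardG.
have [//||t _ ot2] := @Cauchy _ 2 [set: gal_of {:K}]%G; first by rewrite cardG.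
have [w [Uw nzw hex_w]] := hexagonal_unit_exists galK Kreal dimK or3 ot2.
exists w; first exact/(algebraic_unitP iota).
exact: (hexagonal_wandering galK Kreal dimK or3 ot2 Uw nzw hex_w).
Qed.
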